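(* Let $T$ be a binary search tree with $n$ vertices, labeled by $1,\dots,n$ according to the in-order algorithm, let $\trianglelefteq_T$ be the associated partial order, and write the standard modules of $(A_n,\trianglelefteq_T)$ as $\Delta(i)=M(i,s_i)$. Let $B\subset A_n$ be a regular exact Borel subalgebra containing the idempotents $e_1,\dots,e_n$. Let $$S_B=\{e_1,\dots,e_n\}\cup\{\alpha_{s_i}\alpha_{s_i-1}\cdots\alpha_i \mid 1\le i\le n,\ s_i<n\}.$$ Then $S_B$ is a minimal generating set for $B$.
   Context: $K$ is an algebraically closed field and $A_n$ is the path algebra over $K$ of the quiver $1\to 2\to\cdots\to n$ with arrows $\alpha_i:i\to i+1$ and trivial paths $e_i$. Modules are finite-dimensional left modules and paths are composed from right to left, so $\alpha_j\cdots\alpha_i$ is the path from $i$ to $j+1$. $L(i)$ is the simple module at $i$, $P(i)$ its projective cover, and for $i\le j$, $M(i,j)$ is the interval module, i.e. the indecomposable uniserial module with top $L(i)$, socle $L(j)$ and composition factors $L(i),L(i+1),\dots,L(j)$; thus $P(i)=M(i,n)$. A binary tree is either empty or a triple consisting of a root and two binary trees, its left and right subtrees. The in-order algorithm labels the $n$ vertices by $1,\dots,n$ by recursively visiting the left subtree, then the root, then the right subtree. The partial order $\trianglelefteq_T$ is: $i\triangleleft_T j$ iff $i$ labels a vertex in the left or right subtree of the vertex labeled $j$. The standard module $\Delta(i)$ is the largest quotient of $P(i)$ all of whose composition factors $L(j)$ satisfy $j\trianglelefteq_T i$; hence $\Delta(i)=M(i,s_i)$ for a unique $s_i$ with $i\le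 s_i\le n$. The algebra $A_n$ is quasi-hereditary with respect to $\trianglelefteq_T$. Quasi-hereditary: a finite-dimensional algebra $\Lambda$ with simple modules indexed by a partially ordered set is quasi-hereditary if for each $i$ the kernel of $P(i)\twoheadrightarrow\Delta(i)$ has a filtration with subquotients $\Delta(j)$, $j\triangleright i$, and the kernel of $\Delta(i)\twoheadrightarrow L(i)$ has a filtration with subquotients $L(j)$, $j\triangleleft i$. Regular exact Borel subalgebra: let $(\Lambda,\trianglelefteq)$ be quasi-hereditary with $n$ simple modules up to isomorphism. A subalgebra $B\subset\Lambda$ is an exact Borel subalgebra if (i) $B$ also has $n$ simple modules $L_B(1),\dots,L_B(n)$ up to isomorphism and $(B,\trianglelefteq)$ is quasi-hereditary with simple standard modules; (ii) $\Lambda\otimes_B-$ is exact; (iii) $\Lambda\otimes_B L_B(i)\cong\Delta_\Lambda(i)$ for all $i$. It is regular if moreover the maps $\operatorname{Ext}_B^k(L_B(i),L_B(j))\to\operatorname{Ext}_\Lambda^k(\Lambda\otimes_BL_B(i),\Lambda\otimes_BL_B(j))$ induced by $\Lambda\otimes_B-$ are isomorphisms for all $k\ge 1$ and all $i,j$. ''Generating set'' means that every element of $B$ is a $K$-linear combination of products of one or more elements of the set (the unit is not available for free); ''minimal'' means that no proper subset is generating. *)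

(* Defs.v *)
From HB Require Import structures.
From mathcomp Require Import all_boot all_order all_algebra all_field.
From mathcomp Require Import generic_quotient boolp classical_sets.

Set Implicit Arguments.
Unset Strict Implicit.
Unset Printing Implicit Defensive.

Import GRing.Theory.
Local Open Scope ring_scope.
Local Open Scope quotient_scope.

(** * Finite-dimensional modules over a finite-dimensional algebra

  A left module over [R : falgType K] is an [lmodType R]; its K-structure is
  the one induced by [K -> R], [c |-> c%:A]. *)

Section Modules.
Variables (K : fieldType) (R : falgType K).
Implicit Types V W M N P Q D : lmodType R.

Definition findim V : Prop :=
  exists e : seq V, forall v : V, exists c : 'I_(size e) -> K,
    v = \sum_(k < size e) ((c k)%:A : R) *: e`_k.

Definition onto (X Y : Type) (f : X -> Y) : Prop := forall y, exists x, f x = y.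

Definition exact_at M N Q (f : M -> N) (g : N -> Q) : Prop :=
  forall y, g y = 0 <-> exists x, f x = y.

Definition isom V W : Prop := exists f : {linear V -> W}, bijective f.

Definition submodule V (U : set V) : Prop :=
  U 0 /\ forall (a : R) u v, U u -> U v -> U (a *: u + v).

Definition simple_module V : Prop :=
  (exists v : V, v != 0) /\
  forall U : set V, submodule U -> (forall v, U v -> v = 0) \/ (forall v, U v).

(* [U' / U] is isomorphic to [W]: some map that is linear on [U'] sends [U']
   onto [W] with kernel [U].  Values of [f] outside [U'] are irrelevant. *)
Definition subquot_isom V (U U' : set V) W : Prop :=
  exists f : V -> W,
    [/\ forall (a : R) u v, U' u -> U' v -> f (a *: u + v) = a *: f u + f v,
        forall w, exists2 u, U' u & f u = w
      & forall u, U' u -> (f u = 0 <-> U u)].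

(* [filtered_by X J U]: there is a finite chain of submodules from 0 to [U] all
   of whose subquotients are isomorphic to some [X j] with [J j]. *)
Inductive filtered_by (I : Type) (X : I -> lmodType R) (J : pred I) V :
    set V -> Prop :=
| filtered_zero : filtered_by X J [set 0]
| filtered_step (U U' : set V) (j : I) :
    filtered_by X J U -> submodule U' -> (U `<=` U')%classic -> J j ->
    subquot_isom U U' (X j) -> filtered_by X J U'.

Definition projective P : Prop :=
  forall M N (g : {linear M -> N}) (f : {linear P -> N}),
    findim M -> findim N -> onto g ->
    exists h : {linear P -> M}, forall x, g (h x) = f x.

(* The last clause says that the kernel of [p] is superfluous. *)
Definition projective_cover P V (p : {linear P -> V}) : Prop :=
  [/\ findim P, projective P, onto p
    & forall U : set P, submodule U ->
        (forall x, exists2 u, U u & p (x - u) = 0) -> forall x, U x].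

Definition representative_simples (I : Type) (L : I -> lmodType R) : Prop :=
  [/\ forall i, simple_module (L i),
      forall i j, isom (L i) (L j) -> i = j
    & forall V, simple_module V -> exists i, isom V (L i)].

Section QuasiHereditary.
Variables (I : finType) (L : I -> lmodType R) (le : rel I).

(* By Jordan-Hoelder, all composition factors of a module are of the form
   [L j] with [le j i] as soon as this holds for one composition series. *)
Definition factors_below (i : I) V : Prop :=
  filtered_by L (fun j => le j i) [set: V]%classic.

(* [q] exhibits [D] as the largest quotient of [P] with [factors_below i]. *)
Definition standard_quotient (i : I) P D (q : {linear P -> D}) : Prop :=
  [/\ onto q, factors_below i D
    & forall Q (q' : {linear P -> Q}), onto q' -> factors_below i Q ->
        forall x, q x = 0 -> q' x = 0].

Definition is_standard (i : I) D : Prop :=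
  exists P (p : {linear P -> L i}) (q : {linear P -> D}),
    projective_cover p /\ standard_quotient i q.

Definition quasi_hereditary : Prop :=
  [/\ reflexive le, antisymmetric le, transitive le,
      representative_simples L
    & exists (P D : I -> lmodType R) (p : forall i, {linear P i -> L i})
             (q : forall i, {linear P i -> D i})
             (r : forall i, {linear D i -> L i}),
      forall i,
      [/\ projective_cover (p i), standard_quotient i (q i),
          forall x, r i (q i x) = p i x,
          filtered_by D (fun j => (i != j) && le i j) [set x | q i x = 0]%classic
        & filtered_by L (fun j => (j != i) && le j i) [set x | r i x = 0]%classic]].

End QuasiHereditary.

Definition projective_resolution V (P : nat -> lmodType R)
    (d : forall k, {linear P k.+1 -> P k}) (e : {linear P 0 -> V}) : Prop :=
  [/\ forall k, findim (P k) /\ projective (P k),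
      onto e, exact_at (d 0) e & forall k, exact_at (d k.+1) (d k)].

(* For a projective resolution [(P, d)] of [V], [Ext^k(V, N)] with [k >= 1] is
   the group of linear [f : P k -> N] with [cocycle (d k) f], modulo
   [cohomologous (d k.-1)]. *)
Definition cocycle (X Y : lmodType R) N (d : X -> Y) (f : Y -> N) : Prop :=
  forall x, f (d x) = 0.

Definition cohomologous (X Y : lmodType R) N (d : X -> Y) (f g : X -> N) : Prop :=
  exists h : {linear Y -> N}, forall x, f x = g x + h (d x).

End Modules.

(** * Extension of scalars [A \otimes_B M]

  The commutative monoid of formal finite sums of pairs (a, m), modulo the
  congruence generated by biadditivity and B-balancedness, with the action
  of [A] on the left factors. *)

Section TensorDef.
Variables (K : fieldType) (A : falgType K) (B : {aspace A}).
Variable M : lmodType (subvs_of B).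

Inductive tensor_eq : seq (A * M) -> seq (A * M) -> Prop :=
| teq_refl s : tensor_eq s s
| teq_sym s t : tensor_eq s t -> tensor_eq t s
| teq_trans s t u : tensor_eq s t -> tensor_eq t u -> tensor_eq s u
| teq_cat s s' t t' :
    tensor_eq s s' -> tensor_eq t t' -> tensor_eq (s ++ t) (s' ++ t')
| teq_comm s t : tensor_eq (s ++ t) (t ++ s)
| teq_zero m : tensor_eq [:: (0, m)] [::]
| teq_addl a a' m : tensor_eq [:: (a + a', m)] [:: (a, m); (a', m)]
| teq_addr a m m' : tensor_eq [:: (a, m + m')] [:: (a, m); (a, m')]
| teq_bal a (b : subvs_of B) m :
    tensor_eq [:: (a * vsval b, m)] [:: (a, b *: m)].

Definition tensor_rel (s t : seq (A * M)) : bool := `[< tensor_eq s t >].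

Fact tensor_rel_equiv : equiv_class_of tensor_rel.
Proof.
split=> [s | s t | t s u].
- by apply/asboolP; exact: teq_refl.
- by apply/asboolP/asboolP => ?; exact: teq_sym.
- by move=> /asboolP st /asboolP tu; apply/asboolP; apply: teq_trans st tu.
Qed.

Canonical tensor_equiv := EquivRelPack tensor_rel_equiv.

Definition tensor := {eq_quot tensor_equiv}.

HB.instance Definition _ := Choice.on tensor.
HB.instance Definition _ : EqQuotient _ tensor_equiv tensor :=
  EqQuotient.on tensor.

Local Notation cls := (\pi_tensor : seq (A * M) -> tensor).

Lemma tensorP s t : cls s = cls t <-> tensor_eq s t.
Proof.
split; first by move/eqP; rewrite eqmodE => /asboolP.
by move=> st; apply/eqP; rewrite eqmodE; apply/asboolP.
Qed.

Lemma tensor_surj (x : tensor) : exists s, x = cls s.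
Proof. by exists (repr x); rewrite reprK. Qed.

Definition pure (a : A) (m : M) : tensor := cls [:: (a, m)].

Definition lmul_seq (a : A) (s : seq (A * M)) := [seq (a * x.1, x.2) | x <- s].

Definition tensor_add (x y : tensor) : tensor := cls (repr x ++ repr y).
Definition tensor_scale (a : A) (x : tensor) : tensor := cls (lmul_seq a (repr x)).
Definition tensor_opp (x : tensor) : tensor := tensor_scale (-1) x.

Lemma teq_repr s : tensor_eq (repr (cls s)) s.
Proof. by apply/tensorP; rewrite reprK. Qed.

Lemma tensor_addE s t : tensor_add (cls s) (cls t) = cls (s ++ t).
Proof. by apply/tensorP; apply: teq_cat; apply: teq_repr. Qed.

Lemma teq_lmul a s t : tensor_eq s t -> tensor_eq (lmul_seq a s) (lmul_seq a t).
Proof.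
elim=> {s t} /=.
- by move=> s; exact: teq_refl.
- by move=> s t _; exact: teq_sym.
- by move=> s t u _ st _; apply: teq_trans st.
- by move=> s s' t t' _ ss _ tt; rewrite /lmul_seq !map_cat; apply: teq_cat.
- by move=> s t; rewrite /lmul_seq !map_cat; apply: teq_comm.
- by move=> m; rewrite mulr0; apply: teq_zero.
- by move=> x y m; rewrite mulrDr; apply: teq_addl.
- by move=> x m m'; apply: teq_addr.
- by move=> x b m; rewrite mulrA; apply: teq_bal.
Qed.

Lemma tensor_scaleE a s : tensor_scale a (cls s) = cls (lmul_seq a s).
Proof. by apply/tensorP; apply: teq_lmul; apply: teq_repr. Qed.

Lemma tensor_addA : associative tensor_add.
Proof.
move=> x y z; have [s ->] := tensor_surj x; have [t ->] := tensor_surj y; have [u ->] := tensor_surj z.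
by rewrite !tensor_addE catA.
Qed.

Lemma tensor_addC : commutative tensor_add.
Proof.
move=> x y; have [s ->] := tensor_surj x; have [t ->] := tensor_surj y.
by rewrite !tensor_addE; apply/tensorP/teq_comm.
Qed.

Lemma tensor_add0 : left_id (cls [::]) tensor_add.
Proof. by move=> x; have [s ->] := tensor_surj x; rewrite tensor_addE. Qed.

Lemma tensor_scaleDl x a b :
  tensor_scale (a + b) x = tensor_add (tensor_scale a x) (tensor_scale b x).
Proof.
have [s ->] := tensor_surj x; rewrite !tensor_scaleE tensor_addE; apply/tensorP.
elim: s => [|[c m] s IHs] /=; first exact: teq_refl.
rewrite -cat1s -(cat1s (a * c, m)) -(cat1s (b * c, m)).
apply: teq_trans (teq_cat _ IHs) _; first by rewrite mulrDl; exact: teq_addl.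
rewrite -cat1s -!catA; apply: teq_cat; first exact: teq_refl.
rewrite !catA; apply: teq_cat; last exact: teq_refl.
exact: teq_comm.
Qed.

Lemma tensor_scale0 x : tensor_scale 0 x = cls [::].
Proof.
have [s ->] := tensor_surj x; rewrite tensor_scaleE; apply/tensorP.
elim: s => [|[c m] s IHs] /=; first exact: teq_refl.
by rewrite -cat1s mul0r; exact: teq_cat (teq_zero m) IHs.
Qed.

Lemma tensor_scale1 : left_id 1 tensor_scale.
Proof.
move=> x; have [s ->] := tensor_surj x; rewrite tensor_scaleE; congr (cls _).
by elim: s => //= -[c m] s ->; rewrite mul1r.
Qed.

Lemma tensor_scaleA a b x : tensor_scale a (tensor_scale b x) = tensor_scale (a * b) x.
Proof.
have [s ->] := tensor_surj x; rewrite !tensor_scaleE /lmul_seq -map_comp.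
by congr (cls _); apply: eq_map => -[c m] /=; rewrite mulrA.
Qed.

Lemma tensor_scaleDr : right_distributive tensor_scale tensor_add.
Proof.
move=> a x y; have [s ->] := tensor_surj x; have [t ->] := tensor_surj y.
by rewrite tensor_addE !tensor_scaleE tensor_addE /lmul_seq map_cat.
Qed.

Lemma tensor_addN : left_inverse (cls [::]) tensor_opp tensor_add.
Proof.
move=> x; rewrite /tensor_opp -{2}(tensor_scale1 x) -tensor_scaleDl addNr.
exact: tensor_scale0.
Qed.

HB.instance Definition _ :=
  GRing.isZmodule.Build tensor tensor_addA tensor_addC tensor_add0 tensor_addN.

HB.instance Definition _ :=
  GRing.Zmodule_isLmodule.Build A tensor
    tensor_scaleA tensor_scale1 tensor_scaleDr tensor_scaleDl.

End TensorDef.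

Arguments tensor {K A} B M.
Arguments pure {K A} B {M} a m.

Section TensorTheory.
Variables (K : fieldType) (A : falgType K) (B : {aspace A}).
Implicit Types M N : lmodType (subvs_of B).

Lemma tensor_clsD M (s t : seq (A * M)) :
  \pi_(tensor B M) (s ++ t) = \pi_(tensor B M) s + \pi_(tensor B M) t.
Proof. by rewrite -[RHS]/(tensor_add _ _) tensor_addE. Qed.

Lemma tensor_clsZ M a (s : seq (A * M)) :
  a *: \pi_(tensor B M) s = \pi_(tensor B M) (lmul_seq a s).
Proof. by rewrite -[LHS]/(tensor_scale _ _) tensor_scaleE. Qed.

Lemma tensor_clsE M (s : seq (A * M)) :
  \pi_(tensor B M) s = \sum_(x <- s) pure B x.1 x.2.
Proof.
elim: s => [|[a m] s IHs]; first by rewrite big_nil.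
by rewrite big_cons -IHs -tensor_clsD.
Qed.

Lemma pureDl M a a' (m : M) : pure B (a + a') m = pure B a m + pure B a' m.
Proof. by rewrite -tensor_clsD; apply/tensorP/teq_addl. Qed.

Lemma pureDr M a (m m' : M) : pure B a (m + m') = pure B a m + pure B a m'.
Proof. by rewrite -tensor_clsD; apply/tensorP/teq_addr. Qed.

Lemma pure_bal M a b (m : M) : pure B (a * vsval b) m = pure B a (b *: m).
Proof. exact/tensorP/teq_bal. Qed.

Lemma pureZ M a a' (m : M) : a *: pure B a' m = pure B (a * a') m.
Proof. exact: tensor_clsZ. Qed.

Lemma tensor_ind M (Q : tensor B M -> Prop) :
  Q 0 -> (forall a m x, Q x -> Q (pure B a m + x)) -> forall x, Q x.
Proof.
move=> Q0 QD x; have [s ->] := tensor_surj x; elim: s => [|[a m] s IHs]; first exact: Q0.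
by rewrite -cat1s tensor_clsD; apply: QD.
Qed.

Lemma tensor_univ M (X : zmodType) (beta : A -> M -> X) :
  (forall a a' m, beta (a + a') m = beta a m + beta a' m) ->
  (forall a m m', beta a (m + m') = beta a m + beta a m') ->
  (forall a b m, beta (a * vsval b) m = beta a (b *: m)) ->
  exists! g : tensor B M -> X,
    (forall x y, g (x + y) = g x + g y) /\ (forall a m, g (pure B a m) = beta a m).
Proof.
move=> bDl bDr bB; pose ev (s : seq (A * M)) := \sum_(x <- s) beta x.1 x.2.
have b0 m : beta 0 m = 0 by apply: (@addrI _ (beta 0 m)); rewrite -bDl !addr0.
have ev_eq s t : tensor_eq s t -> ev s = ev t.
  elim=> {s t} //=.
  - by move=> s t u _ -> _ ->.
  - by move=> s s' t t' _ ss _ tt; rewrite /ev !big_cat -!/(ev _) /= ss tt.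
  - by move=> s t; rewrite /ev !big_cat /= addrC.
  - by move=> m; rewrite /ev big_seq1 big_nil.
  - by move=> a a' m; rewrite /ev big_seq1 big_cons big_seq1 bDl.
  - by move=> a m m'; rewrite /ev big_seq1 big_cons big_seq1 bDr.
  - by move=> a b m; rewrite /ev !big_seq1 bB.
pose g (x : tensor B M) := ev (repr x).
have gE s : g (\pi s) = ev s by apply/ev_eq/teq_repr.
exists g; split.
  split=> [|a m]; last by rewrite gE /ev big_seq1.
  move=> x y; have [t ->] := tensor_surj x; have [u ->] := tensor_surj y.
  by rewrite -tensor_clsD !gE /ev big_cat.
move=> h [hD hp]; apply/funext => x; have [s ->] := tensor_surj x; rewrite gE.
elim: s => [|[a m] s IHs].
  by rewrite /ev big_nil; apply: (@addrI _ (h 0)); rewrite -hD !addr0.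
by rewrite -cat1s tensor_clsD hD -IHs hp /ev big_cons.
Qed.

Definition tensor_map M N (f : {linear M -> N}) (x : tensor B M) : tensor B N :=
  \pi_(tensor B N) [seq (y.1, f y.2) | y <- repr x].

Lemma tensor_map_cls M N (f : {linear M -> N}) s :
  tensor_map f (\pi s) = \pi_(tensor B N) [seq (y.1, f y.2) | y <- s].
Proof.
apply/tensorP; move: (repr _) (teq_repr s) => r.
elim=> {r s} /=.
- by move=> s; exact: teq_refl.
- by move=> s t _; exact: teq_sym.
- by move=> s t u _ st _; apply: teq_trans st.
- by move=> s s' t t' _ ss _ tt; rewrite !map_cat; apply: teq_cat.
- by move=> s t; rewrite !map_cat; apply: teq_comm.
- by move=> m; apply: teq_zero.
- by move=> x y m; apply: teq_addl.
- by move=> x m m'; rewrite linearD; apply: teq_addr.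
- by move=> x b m; rewrite linearZ; apply: teq_bal.
Qed.

Lemma tensor_map_pure M N (f : {linear M -> N}) a m :
  tensor_map f (pure B a m) = pure B a (f m).
Proof. exact: tensor_map_cls. Qed.

Lemma tensor_map_is_linear M N (f : {linear M -> N}) : linear (tensor_map f).
Proof.
move=> a x y; have [s ->] := tensor_surj x; have [t ->] := tensor_surj y.
rewrite tensor_clsZ -tensor_clsD !tensor_map_cls map_cat tensor_clsD tensor_clsZ.
by rewrite /lmul_seq -!map_comp.
Qed.

HB.instance Definition _ M N (f : {linear M -> N}) :=
  GRing.isLinear.Build A (tensor B M) (tensor B N) *:%R (tensor_map f)
    (tensor_map_is_linear f).

End TensorTheory.

Section Borel.
Variables (K : fieldType) (A : falgType K) (B : {aspace A}).

Definition tensor_exact : Prop :=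
  forall (M' M M'' : lmodType (subvs_of B))
         (f : {linear M' -> M}) (g : {linear M -> M''}),
    findim M' -> findim M -> findim M'' ->
    injective f -> exact_at f g -> onto g ->
    [/\ injective (tensor_map f), exact_at (tensor_map f) (tensor_map g)
      & onto (tensor_map g)].

Variables (I : finType) (L : I -> lmodType A) (le : rel I).

(* [1 \in B]: an [{aspace A}] may have its own unit, whereas a subalgebra
   shares the unit of [A]. *)
Definition exact_borel (LB : I -> lmodType (subvs_of B)) : Prop :=
  [/\ 1 \in B,
      quasi_hereditary LB le /\
        (forall i D, is_standard LB le i D -> simple_module D),
      tensor_exact
    & forall i D, is_standard L le i D -> isom (tensor B (LB i)) D].

(* Bijectivity of [Ext_B^(k+1)(LB i, LB j) ->
   Ext_A^(k+1)(A \otimes LB i, A \otimes LB j)].  As [A \otimes_B -] is exact and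
   preserves projectives, it sends a projective resolution of [LB i] to one of
   [A \otimes LB i], and the map is [f] |-> [tensor_map f] on cocycles. *)
Definition ext_regular (LB : I -> lmodType (subvs_of B)) : Prop :=
  forall (i j : I) (P : nat -> lmodType (subvs_of B))
         (d : forall k, {linear P k.+1 -> P k}) (e : {linear P 0 -> LB i}),
    projective_resolution d e ->
    forall k : nat,
      (forall f f' : {linear P k.+1 -> LB j},
         cocycle (d k.+1) f -> cocycle (d k.+1) f' ->
         cohomologous (tensor_map (d k)) (tensor_map f) (tensor_map f') ->
         cohomologous (d k) f f') /\
      (forall g : {linear tensor B (P k.+1) -> tensor B (LB j)},
         cocycle (tensor_map (d k.+1)) g ->
         exists2 f : {linear P k.+1 -> LB j},
           cocycle (d k.+1) f
           & cohomologous (tensor_map (d k)) g (tensor_map f)).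

Definition regular_exact_borel : Prop :=
  exists LB : I -> lmodType (subvs_of B), exact_borel LB /\ ext_regular LB.

End Borel.

Section Generating.
Variables (K : fieldType) (A : falgType K).

Definition generated_by (S : set A) (a : A) : Prop :=
  exists (m : nat) (c : 'I_m -> K) (w : 'I_m -> seq A),
    (forall k, w k != [::] /\ (forall x, x \in w k -> S x)) /\
    a = \sum_(k < m) c k *: \prod_(x <- w k) x.

Definition generating_set (S : set A) (B : {aspace A}) : Prop :=
  (forall x, S x -> x \in B) /\ (forall b, b \in B -> generated_by S b).

Definition minimal_generating_set (S : set A) (B : {aspace A}) : Prop :=
  generating_set S B /\
  forall S' : set A, (S' `<` S)%classic -> ~ generating_set S' B.

End Generating.

(** * The path algebra of the linear quiver

  The vertices are ['I_n.+1] (numbered from 0), and the arrows [alpha k],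
  [k : 'I_n], go from [k] to [k + 1].  There is one path from [i] to [j] when
  [i <= j] and none otherwise, so a path is encoded by its two ends. *)

Definition qpath (n : nat) := {p : 'I_n.+1 * 'I_n.+1 | (p.1 <= p.2)%N}.

Definition source n (p : qpath n) : 'I_n.+1 := (val p).1.
Definition target n (p : qpath n) : 'I_n.+1 := (val p).2.

Definition pathalg (K : fieldType) (n : nat) := {ffun qpath n -> K^o}.

Section PathAlgebra.
Variables (K : fieldType) (n : nat).
Local Notation A := (pathalg K n).

HB.instance Definition _ := Vector.on A.

Implicit Types (x y z : A) (i j k l : 'I_n.+1).

(* Coefficient of the path from [i] to [j]; 0 if there is no such path. *)
Definition pcoef (x : A) (i j : 'I_n.+1) : K :=
  if insub (i, j) is Some p then x p else 0.

(* A factorization of a path r as "q, then p" is determined by its middle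
   vertex l; composition is from right to left. *)
Definition pathmul (x y : A) : A :=
  [ffun r => \sum_(l < n.+1) pcoef x l (target r) * pcoef y (source r) l].

Definition path_elt (i j : 'I_n.+1) : A :=
  [ffun r => ((source r == i) && (target r == j))%:R].

Definition pathone : A := \sum_(i < n.+1) path_elt i i.

Lemma pcoef_gt x i j : ~~ (i <= j)%N -> pcoef x i j = 0.
Proof. by move=> ij; rewrite /pcoef insubN. Qed.

Lemma pcoef_val (x : A) (p : qpath n) : pcoef x (source p) (target p) = x p.
Proof. by rewrite /pcoef /source /target -surjective_pairing valK. Qed.

Lemma pcoef_inj (x y : A) : (forall i j, pcoef x i j = pcoef y i j) -> x = y.
Proof. by move=> xy; apply/ffunP => p; rewrite -!pcoef_val. Qed.

Lemma pcoefE (f : qpath n -> K^o) (i j : 'I_n.+1) (ij : (i <= j)%N) :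
  pcoef [ffun p => f p] i j = f (exist _ (i, j) ij).
Proof.
rewrite /pcoef; case: insubP => [p _ pE | /negP//]; rewrite ffunE.
by congr f; apply: val_inj.
Qed.

Lemma pcoefM x y i j :
  pcoef (pathmul x y) i j = \sum_(l < n.+1) pcoef x l j * pcoef y i l.
Proof.
have [ij | ij] := boolP (i <= j)%N; first by rewrite pcoefE.
rewrite pcoef_gt // big1 // => l _.
have [il | il] := boolP (i <= l)%N; last by rewrite (pcoef_gt y il) mulr0.
rewrite pcoef_gt ?mul0r //; apply: contra ij; exact: leq_trans.
Qed.

Lemma pcoefD x y i j : pcoef (x + y) i j = pcoef x i j + pcoef y i j.
Proof. by rewrite /pcoef; case: insub => [p|]; rewrite ?ffunE ?addr0. Qed.

Lemma pcoefZ (c : K) x i j : pcoef (c *: x) i j = c * pcoef x i j.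
Proof. by rewrite /pcoef; case: insub => [p|]; rewrite ?ffunE ?mulr0. Qed.

Lemma pcoef0 i j : pcoef 0 i j = 0.
Proof. by rewrite /pcoef; case: insub => [p|]; rewrite ?ffunE. Qed.

Lemma pcoef_path k l i j :
  pcoef (path_elt k l) i j = [&& (i <= j)%N, i == k & j == l]%:R.
Proof.
by have [ij | ij] := boolP (i <= j)%N; [rewrite pcoefE | rewrite pcoef_gt].
Qed.

Lemma pcoef1 i j : pcoef pathone i j = (i == j)%:R.
Proof.
have -> : pcoef pathone i j = \sum_(l < n.+1) pcoef (path_elt l l) i j.
  apply: (big_morph (fun x => pcoef x i j)); last exact: pcoef0.
  by move=> x y; apply: pcoefD.
rewrite (bigD1 i) //= big1 => [|l li].
  by rewrite pcoef_path eqxx addr0 /= eq_sym; case: eqVneq => [->|]; rewrite ?leqnn ?andbF.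
by rewrite pcoef_path (eq_sym i) (negPf li) andbF.
Qed.

Lemma pathmulA : associative pathmul.
Proof.
move=> x y z; apply: pcoef_inj => i j; rewrite !pcoefM.
under eq_bigr do rewrite pcoefM mulr_sumr.
under [RHS]eq_bigr do rewrite pcoefM mulr_suml.
rewrite exchange_big /=; apply: eq_bigr => l _.
by apply: eq_bigr => m _; rewrite mulrA.
Qed.

Lemma pathmul1l : left_id pathone pathmul.
Proof.
move=> x; apply: pcoef_inj => i j; rewrite pcoefM (bigD1 j) //= pcoef1 eqxx mul1r.
by rewrite big1 ?addr0 // => l lj; rewrite pcoef1 (negPf lj) mul0r.
Qed.

Lemma pathmul1r : right_id pathone pathmul.
Proof.
move=> x; apply: pcoef_inj => i j; rewrite pcoefM (bigD1 i) //= pcoef1 eqxx mulr1.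
by rewrite big1 ?addr0 // => l li; rewrite pcoef1 eq_sym (negPf li) mulr0.
Qed.

Lemma pathmulDl : left_distributive pathmul +%R.
Proof.
move=> x y z; apply: pcoef_inj => i j; rewrite pcoefD !pcoefM -big_split /=.
by apply: eq_bigr => l _; rewrite pcoefD mulrDl.
Qed.

Lemma pathmulDr : right_distributive pathmul +%R.
Proof.
move=> x y z; apply: pcoef_inj => i j; rewrite pcoefD !pcoefM -big_split /=.
by apply: eq_bigr => l _; rewrite pcoefD mulrDr.
Qed.

Lemma pathone_neq0 : pathone != 0.
Proof.
apply/eqP => /(congr1 (fun x => pcoef x ord0 ord0)).
by rewrite pcoef1 pcoef0 eqxx => /eqP; rewrite oner_eq0.
Qed.

HB.instance Definition _ := GRing.Zmodule_isNzRing.Build A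
  pathmulA pathmul1l pathmul1r pathmulDl pathmulDr pathone_neq0.

Lemma pathscaleAl (c : K) (x y : A) : c *: (x * y) = (c *: x) * y.
Proof.
apply: pcoef_inj => i j; rewrite pcoefZ !pcoefM mulr_sumr.
by apply: eq_bigr => l _; rewrite pcoefZ mulrA.
Qed.

Lemma pathscaleAr (c : K) (x y : A) : c *: (x * y) = x * (c *: y).
Proof.
apply: pcoef_inj => i j; rewrite pcoefZ !pcoefM mulr_sumr.
by apply: eq_bigr => l _; rewrite pcoefZ mulrCA.
Qed.

HB.instance Definition _ := GRing.Lmodule_isLalgebra.Build K A pathscaleAl.
HB.instance Definition _ := GRing.Lalgebra_isAlgebra.Build K A pathscaleAr.
HB.instance Definition _ := Algebra_isFalgebra.Build K A.

Definition idem (i : 'I_n.+1) : A := path_elt i i.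

Definition alpha (k : 'I_n) : A := path_elt (widen_ord (leqnSn n) k) (lift ord0 k).

(* alpha_j ... alpha_(i+1) alpha_i, the largest index on the left. *)
Definition alpha_prod (i j : nat) : A :=
  \prod_(a <- rev [seq a : 'I_n <- enum 'I_n | (i <= a <= j)%N]) alpha a.

Lemma path_eltM i j k l : (i <= j)%N -> (k <= l)%N ->
  path_elt k l * path_elt i j = if j == k then path_elt i l else 0.
Proof.
move=> ij kl; apply: pcoef_inj => u v; rewrite pcoefM (bigD1 k) //= big1; last first.
  by move=> m mk; rewrite pcoef_path (negPf mk) andbF mul0r.
rewrite !pcoef_path addr0 eqxx (eq_sym k) /=; have [jk | _] := eqVneq j k.
  rewrite pcoef_path andbT; have [-> | _] := eqVneq u i; last by rewrite !andbF mulr0.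
  have [-> | _] := eqVneq v l; last by rewrite !andbF mul0r.
  by rewrite kl -jk ij (leq_trans ij) ?mulr1 // jk.
by rewrite !andbF mulr0 pcoef0.
Qed.

Lemma alpha_prodE i j l : (i <= j)%N -> l = j.+1 :> nat ->
  alpha_prod i j = path_elt i l.
Proof.
move=> ij lj; have jn : (j < n)%N by rewrite -ltnS -lj.
rewrite /alpha_prod; set s := [seq _ <- _ | _].
have: [seq val a | a <- s] = iota i (j.+1 - i).
  rewrite /s -(@filter_map _ _ (val : 'I_n -> nat) (fun a => (i <= a <= j)%N)).
  rewrite val_enum_ord; apply: (irr_sorted_eq ltn_trans ltnn).
  - by apply: sorted_filter; [exact: ltn_trans | exact: iota_ltn_sorted].
  - exact: iota_ltn_sorted.
  move=> a; rewrite mem_filter !mem_iota add0n subnKC ?ltnS ?(leqW ij) //=.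
  case: (i <= a)%N => //=; have [aj | //] := leqP a j.
  exact: leq_ltn_trans aj jn.
have: l = (i + (j - i).+1)%N :> nat by rewrite addnS subnKC.
rewrite subSn //; move: s (j - i)%N => s m {ij lj jn}.
elim: m s l => [|m IHm] s l lE.
  case: s => [|a []] //= [ai]; rewrite big_seq1 /alpha.
  by congr (path_elt _ _); apply: val_inj => /=; rewrite ?lift0 ?lE ?addn1 ?ai.
case/lastP: s => [|s a] //; rewrite map_rcons -[m.+2]addn1 iotaD cats1.
move=> /rcons_inj[sE aE]; rewrite rev_rcons big_cons.
rewrite (IHm s (widen_ord (leqnSn n) a)) // /alpha path_eltM ?eqxx //=.
- by congr (path_elt _ _); apply: val_inj => /=; rewrite ?lift0 lE [in LHS]aE !addnS.
- by rewrite aE leq_addr.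
Qed.

Lemma path_elt_sum (x : A) :
  x = \sum_(p : qpath n) x p *: path_elt (source p) (target p).
Proof.
apply/ffunP=> r; rewrite sum_ffunE (bigD1 r) //= big1 => [|p pr].
  by rewrite !ffunE !eqxx addr0 [RHS]mulr1.
rewrite !ffunE (_ : _ && _ = false) ?[LHS]mulr0 //.
apply: contraNF pr => /andP[/eqP srp /eqP trp]; apply/eqP/val_inj.
by rewrite [RHS]surjective_pairing [LHS]surjective_pairing; congr (_, _).
Qed.

End PathAlgebra.

(** * Interval modules

  [intmod K i j] has basis the vertices [k] with [i <= k <= j]; a path from [k] to
  [l] sends the basis vector [k] to the basis vector [l] (to 0 if [l > j]) and
  kills the other basis vectors. *)

Definition interval_vertex n (i j : 'I_n.+1) := {k : 'I_n.+1 | (i <= k <= j)%N}.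

Definition intmod (K : fieldType) n (i j : 'I_n.+1) :=
  {ffun interval_vertex i j -> K^o}.

Section IntervalModule.
Variables (K : fieldType) (n : nat) (i j : 'I_n.+1).
Local Notation A := (pathalg K n).
Local Notation M := (intmod K i j).

HB.instance Definition _ := GRing.Zmodule.on M.

Definition intscale (a : A) (v : M) : M :=
  [ffun l => \sum_(k : interval_vertex i j) pcoef a (val k) (val l) * v k].

Lemma intscaleA a b v : intscale a (intscale b v) = intscale (a * b) v.
Proof.
apply/ffunP => m; rewrite !ffunE.
under eq_bigr do rewrite ffunE mulr_sumr.
rewrite exchange_big /=; apply: eq_bigr => k _; rewrite pcoefM mulr_suml.
rewrite (bigID (fun l : 'I_n.+1 => (i <= l <= j)%N)) /= [X in _ + X]big1 ?addr0.
  rewrite (reindex_omap (val : interval_vertex i j -> _) insub) /=.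
    apply: eq_big => [l | l _]; last by rewrite mulrA.
    by rewrite valK eqxx andbT (valP l).
  by move=> l il; rewrite insubT.
move=> l; case/nandP => Hl.
  rewrite (@pcoef_gt _ _ b) ?mulr0 ?mul0r //; apply: contra Hl.
  by apply: leq_trans; case/andP: (valP k).
rewrite (@pcoef_gt _ _ a) ?mul0r //; apply: contra Hl => lm.
by apply: leq_trans lm _; case/andP: (valP m).
Qed.

Lemma intscale1 : left_id 1 intscale.
Proof.
move=> v; apply/ffunP => l; rewrite ffunE (bigD1 l) //= pcoef1 eqxx mul1r.
rewrite big1 ?addr0 // => k kl; rewrite pcoef1.
by rewrite (inj_eq val_inj) (negPf kl) mul0r.
Qed.

Lemma intscaleDr : right_distributive intscale +%R.
Proof.
move=> a v w; apply/ffunP => l; rewrite !ffunE -big_split /=.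
by apply: eq_bigr => k _; rewrite ffunE mulrDr.
Qed.

Lemma intscaleDl v : {morph intscale^~ v : a b / a + b}.
Proof.
move=> a b; apply/ffunP => l; rewrite !ffunE -big_split /=.
by apply: eq_bigr => k _; rewrite pcoefD mulrDl.
Qed.

HB.instance Definition _ := GRing.Zmodule_isLmodule.Build A M
  intscaleA intscale1 intscaleDr intscaleDl.

End IntervalModule.

Inductive bintree (X : Type) : Type :=
| BLeaf
| BNode (l : bintree X) (x : X) (r : bintree X).

Arguments BLeaf {X}.

(* The labels in the order in which the in-order algorithm visits the vertices. *)
Fixpoint inorder (X : Type) (T : bintree X) : seq X :=
  if T is BNode l x r then inorder l ++ x :: inorder r else [::].

Fixpoint tree_lt (X : eqType) (T : bintree X) (i j : X) : bool :=
  if T is BNode l x r then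
    [|| (j == x) && ((i \in inorder l) || (i \in inorder r)),
        tree_lt l i j | tree_lt r i j]
  else false.

Definition tree_le (X : eqType) (T : bintree X) (i j : X) : bool :=
  (i == j) || tree_lt T i j.

(* [s i < n] says that [s i] is not the last vertex. *)
Definition borel_generators (K : fieldType) n (s : 'I_n.+1 -> 'I_n.+1) :
    set (pathalg K n) :=
  [set a | (exists i, a = idem K i) \/
           (exists2 i, (s i < n)%N & a = alpha_prod K n i (s i))]%classic.

Arguments borel_generators K {n} s.

(* Main.v *)
(* As [B] contains the idempotents, it is spanned by the paths it contains; write
   i ~> j when the path from i to j lies in [B].  A simple [B]-module lives on a single
   vertex v, and the path from v to w kills its extension of scalars iff v ~> k for
   some v < k <= w.  Comparing with the action on M(i, s_i) gives v = i and shows that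
   s_i + 1 is the least k > i with i ~> k.  Exactness of the extension of scalars, for
   the inclusion into the projective at h of the submodule generated by two paths
   h ~> i and h ~> j with i <= j, forces i ~> j.  Hence every path in [B] from i to j
   with i < j factors in [B] through s_i + 1.  A generator is indispensable because the
   elements of [B] in which its coefficient vanishes are closed under products. *)

From HB Require Import structures.
Require Import Defs.
From mathcomp Require Import boolp.
From mathcomp Require Import all_boot all_order all_algebra falgebra.

Set Implicit Arguments.
Unset Strict Implicit.
Unset Printing Implicit Defensive.

Import GRing.Theory.
Local Open Scope ring_scope.

(** * Coefficients of products with a path *)

Section PathCoefficients.
Variables (K : fieldType) (n : nat).
Local Notation A := (pathalg K n).
Implicit Types (x y : A) (i j k l : 'I_n.+1).

Lemma pcoef_mulr x y i j :
  pcoef (x * y) i j = \sum_(l < n.+1) pcoef x l j * pcoef y i l.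
Proof. exact: pcoefM. Qed.

Lemma pcoef_sum (I : Type) (r : seq I) (P : pred I) (F : I -> A) i j :
  pcoef (\sum_(a <- r | P a) F a) i j = \sum_(a <- r | P a) pcoef (F a) i j.
Proof.
by apply: (big_morph (fun x => pcoef x i j)) => [x y|];
  [exact: pcoefD | exact: pcoef0].
Qed.

Lemma pcoef_path_mul i j x k l : (i <= j)%N ->
  pcoef (path_elt K i j * x) k l = (l == j)%:R * pcoef x k i.
Proof.
move=> ij; rewrite pcoef_mulr (bigD1 i) //= big1 ?addr0 => [|m mi].
  by rewrite pcoef_path eqxx /=; case: eqP => [->|_]; rewrite ?ij ?andbF.
by rewrite pcoef_path (negPf mi) andbF mul0r.
Qed.

Lemma pcoef_mul_path i j x k l : (i <= j)%N ->
  pcoef (x * path_elt K i j) k l = (k == i)%:R * pcoef x j l.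
Proof.
move=> ij; rewrite pcoef_mulr (bigD1 j) //= big1 ?addr0 => [|m mj].
  by rewrite pcoef_path eqxx andbT mulrC; case: eqP => [->|_]; rewrite ?ij ?andbF.
by rewrite pcoef_path (negPf mj) !andbF mulr0.
Qed.

(** Of the paths occurring in [x], only the one from [j] to [k] composes with both outer paths, so
    this cuts a single coefficient out of [x]. *)
Lemma path_corner i j x k l : (i <= j)%N -> (k <= l)%N ->
  path_elt K k l * x * path_elt K i j = pcoef x j k *: path_elt K i l.
Proof.
move=> ij kl; apply: pcoef_inj => u v; rewrite pcoefZ pcoef_mul_path // pcoef_path_mul //.
rewrite pcoef_path; have [jk|jk] := leqP j k; last first.
  by rewrite (@pcoef_gt _ _ x) ?mulr0 ?mul0r // -ltnNge.
case: (u =P i) => [->|_]; last by rewrite andbF mulr0 mul0r.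
case: (v =P l) => [->|_]; last by rewrite !andbF !(mulr0, mul0r).
by rewrite (leq_trans ij) ?(leq_trans jk) ?mulr1 ?mul1r.
Qed.

Lemma path_mul i j k : (i <= j)%N -> (j <= k)%N ->
  path_elt K j k * path_elt K i j = path_elt K i k.
Proof. by move=> ij jk; rewrite path_eltM ?eqxx. Qed.

Lemma pcoef_path_id i j : (i <= j)%N -> pcoef (path_elt K i j) i j = 1.
Proof. by move=> ij; rewrite pcoef_path ij !eqxx. Qed.

Lemma sum_idem : \sum_(k < n.+1) idem K k = 1.
Proof. by []. Qed.

End PathCoefficients.

(** * Annihilators of interval modules *)

Section IntervalAction.
Variables (K : fieldType) (n : nat) (i j : 'I_n.+1).

Lemma path_annihilates_intmod (v w : 'I_n.+1) : (v <= w)%N ->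
  (forall x : intmod K i j, path_elt K v w *: x = 0) <-> ~~ ((i <= v)%N && (w <= j)%N).
Proof.
move=> vw; split => [H|/negP H x].
  apply/negP => /andP[iv wj].
  have Pv : (i <= v <= j)%N by rewrite iv (leq_trans vw).
  have Pw : (i <= w <= j)%N by rewrite wj (leq_trans iv).
  pose d : intmod K i j := [ffun l => (val l == v)%:R].
  move: (congr1 (fun y : intmod K i j => y (exist _ w Pw)) (H d)).
  rewrite !ffunE (bigD1 (exist _ v Pv)) //= big1 ?addr0 => [|m mv].
    by rewrite ffunE /= pcoef_path vw !eqxx mulr1 => /eqP; rewrite oner_eq0.
  by rewrite ffunE -(inj_eq val_inj) /= in mv *; rewrite (negPf mv) mulr0.
apply/ffunP => l; rewrite !ffunE big1 // => k _; rewrite pcoef_path.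
case: eqP => [kv|_]; last by rewrite andbF mul0r.
case: eqP => [lw|_]; last by rewrite !andbF mul0r.
by case: H; rewrite -kv -lw; case/andP: (valP k) => ->; case/andP: (valP l) => _ ->.
Qed.

End IntervalAction.

(** Annihilators are the invariant by which an extension of scalars is compared with an interval
    module. *)
Lemma isom_annihilates (K : fieldType) (R : falgType K) (V W : lmodType R) (a : R) :
  isom V W -> (forall x : V, a *: x = 0) <-> (forall y : W, a *: y = 0).
Proof.
case=> f [g gK fK]; split=> H x.
  by rewrite -(fK x) -(linearZ_LR f) H linear0.
by apply: (can_inj gK); rewrite (linearZ_LR f) H linear0.
Qed.

(** * Subalgebras containing the idempotents, and their simple modules *)

Section Subalgebra.
Variables (K : fieldType) (n : nat).
Local Notation A := (pathalg K n).
Variable B : {aspace A}.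
Implicit Types (x y : A) (b : subvs_of B) (i j k l : 'I_n.+1).

(** The relation [i ~> j]. The inequality is demanded because for [i > j] the element
    [path_elt K i j] is 0 and would lie in [B]. *)
Definition conn i j : bool := (i <= j)%N && (path_elt K i j \in B).

Lemma conn_leq i j : conn i j -> (i <= j)%N.
Proof. by case/andP. Qed.

Lemma conn_mem i j : conn i j -> path_elt K i j \in B.
Proof. by case/andP. Qed.

Lemma conn_trans j i k : conn i j -> conn j k -> conn i k.
Proof.
move=> /andP[ij Bij] /andP[jk Bjk]; rewrite /conn (leq_trans ij jk) -(path_mul K ij jk).
exact: memvM.
Qed.

Hypothesis he : forall i, idem K i \in B.

Lemma conn_refl i : conn i i.
Proof. by rewrite /conn leqnn /= he. Qed.

Lemma mem_one : 1 \in B.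
Proof. by rewrite -sum_idem; apply: memv_suml => k _; apply: he. Qed.

Lemma vsval_one : vsval (1 : subvs_of B) = 1.
Proof. by apply/eqP; rewrite algid_eq1; apply: mem_one. Qed.

(** Multiplying [x] by [e_j] on the left and [e_i] on the right stays in [B] and leaves a nonzero
    multiple of one path. *)
Lemma pcoef_conn x i j : x \in B -> pcoef x i j != 0 -> conn i j.
Proof.
move=> Bx xij; apply/andP; split.
  by apply: contraNT xij => ij; rewrite pcoef_gt.
have: idem K j * x * idem K i \in B by rewrite !memvM.
by rewrite path_corner // rpredZeq (negPf xij).
Qed.

Lemma pcoef_nconn x i j : x \in B -> ~~ conn i j -> pcoef x i j = 0.
Proof. by move=> Bx; apply: contraNeq; apply: pcoef_conn. Qed.

Definition idemB k : subvs_of B := Subvs (he k).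

Lemma sum_idemB : \sum_(k < n.+1) idemB k = 1.
Proof. by apply: val_inj; rewrite linear_sum; apply: etrans (esym vsval_one). Qed.

(** If the path from [l] to [k] is not in [B], its coefficient in [b] is 0, so the value of [vsproj]
    does not matter. *)
Lemma idemB_corner b k l :
  idemB k * b * idemB l = pcoef (vsval b) l k *: vsproj B (path_elt K l k).
Proof.
apply: val_inj; rewrite /= path_corner //.
have [/andP[_ /vsprojK->]//|lk] := boolP (conn l k).
by rewrite (pcoef_nconn (subvsP b) lk) !scale0r.
Qed.

Lemma idemB_mul_self b k : idemB k * b * idemB k = pcoef (vsval b) k k *: idemB k.
Proof. by apply: val_inj; rewrite /= path_corner. Qed.

Section SimpleModules.
Variable V : lmodType (subvs_of B).

Lemma idemB_scale k b (y : V) :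
  idemB k *: (b *: y) = \sum_(l < n.+1 | (l <= k)%N) (idemB k * b) *: (idemB l *: y).
Proof.
rewrite scalerA -[X in X *: y]mulr1 -sum_idemB mulr_sumr scaler_suml.
rewrite (bigID (fun l : 'I_n.+1 => (l <= k)%N)) /= [X in _ + X]big1 ?addr0 => [|l lk].
  by apply: eq_bigr => l _; rewrite scalerA.
by rewrite idemB_corner pcoef_gt // !scale0r.
Qed.

(** No path leads to a smaller vertex, so a vector without components below [t] acquires none. *)
Lemma supported_submodule (t : nat) :
  submodule (fun y : V => forall k, (k < t)%N -> idemB k *: y = 0).
Proof.
split=> [k _|b u v Uu Uv k kt]; first by rewrite scaler0.
rewrite scalerDr Uv // addr0 idemB_scale big1 // => l lk.
by rewrite Uu ?scaler0 // (leq_ltn_trans lk).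
Qed.

(** By simplicity, the submodules supported from [v] on and from [v.+1] on are everything and 0
    respectively, so [V] is concentrated at [v]. *)
Lemma simple_module_scalar : simple_module V ->
  exists v, forall b (m : V), b *: m = (pcoef (vsval b) v v)%:A *: m.
Proof.
case=> -[m m0 smp].
have [v vm] : exists v, idemB v *: m != 0.
  apply/existsP; apply: contraNT m0; rewrite negb_exists => /forallP H.
  rewrite -[m]scale1r -sum_idemB scaler_suml big1 // => k _.
  by apply/eqP; move: (H k); rewrite negbK.
have idemv k : k != v -> idemB k *: (idemB v *: m) = 0.
  move=> kv; rewrite scalerA (_ : _ * _ = 0) ?scale0r //; apply: val_inj => /=.
  by rewrite path_eltM // eq_sym (negPf kv).
(* The submodule supported from [v] on contains the nonzero vector [idemB v *: m]. *)
have below (y : V) k : (k < v)%N -> idemB k *: y = 0.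
  case: (smp _ (supported_submodule v)) => [U0|]; last by apply.
  case/eqP: vm; apply: U0 => l lv; apply: idemv.
  by apply: contraTneq lv => ->; rewrite ltnn.
(* The submodule supported from [v.+1] on does not contain [m]. *)
have zero (y : V) : (forall k, (k <= v)%N -> idemB k *: y = 0) -> y = 0.
  move: y; case: (smp _ (supported_submodule v.+1)) => // Uall.
  by move: (Uall m v (leqnn _)) => /eqP; rewrite (negPf vm).
exists v => b y; apply/eqP; rewrite -subr_eq0; apply/eqP/zero => k.
rewrite leq_eqVlt => /orP[/eqP/val_inj->|]; last exact: below.
rewrite scalerBr idemB_scale (bigD1 v) //= big1 ?addr0 => [|l /andP[lv ne]].
  rewrite !scalerA idemB_mul_self mulr_algr subrr //.
by rewrite below ?scaler0 // ltn_neqAle lv andbT.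
Qed.

Variable v : 'I_n.+1.
Hypothesis scalV : forall b (m : V), b *: m = (pcoef (vsval b) v v)%:A *: m.

(** [e_v] acts on [V] as 1 and moves across the tensor sign, so left factors may be taken in
    [A e_v]. *)
Lemma pure_mul_idem a (m : V) : pure B (a * idem K v) m = pure B a m.
Proof.
rewrite -[idem K v]/(vsval (idemB v)) pure_bal scalV /= pcoef_path_id //.
by rewrite scale1r scale1r.
Qed.

Lemma pure0r a : pure B a (0 : V) = 0.
Proof. by apply: (@addrI _ (pure B a (0 : V))); rewrite -pureDr !addr0. Qed.

Lemma pure0l (m : V) : pure B 0 m = 0.
Proof. by apply: (@addrI _ (pure B 0 m)); rewrite -pureDl !addr0. Qed.

Lemma annihilates_tensor a :
  (forall (c : A) (m : V), pure B (a * (c * idem K v)) m = 0) ->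
  forall z : tensor B V, a *: z = 0.
Proof.
move=> H; apply: tensor_ind => [|c m z IHz]; first by rewrite scaler0.
by rewrite scalerDr IHz addr0 -pure_mul_idem pureZ H.
Qed.

Lemma idem_annihilates_tensor k (z : tensor B V) : (k < v)%N -> idem K k *: z = 0.
Proof.
move=> kv; apply: annihilates_tensor => c m.
by rewrite mulrA path_corner // pcoef_gt -?ltnNge // scale0r pure0l.
Qed.

(** If [v ~> k] with [v < k], this path moves across the tensor sign and acts on [V] by its
    coefficient at [e_v], which is 0. Without such a [k], taking the coefficient at the path from
    [v] to [w] is balanced and yields a map that detects the tensor of this path with [m]. *)
Lemma path_annihilates_tensor (w : 'I_n.+1) : (exists m : V, m != 0) -> (v <= w)%N ->
  (forall z : tensor B V, path_elt K v w *: z = 0) <->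
  (exists k, [/\ (v < k)%N, (k <= w)%N & conn v k]).
Proof.
move=> [m m0] vw; split=> [H|[k [vk kw /andP[_ Bvk]]] z].
  apply: contrapT => nconn.
  pose beta (a : A) (u : V) : V := (pcoef a v w)%:A *: u.
  have [||| g [[gD gp] _]] := @tensor_univ K A B V V beta.
  - by move=> a a' u; rewrite /beta pcoefD scalerDl scalerDl.
  - by move=> a u u'; rewrite /beta scalerDr.
  - move=> a b u; rewrite /beta (scalV b) pcoef_mulr (bigD1 v) //= big1 ?addr0.
      by rewrite scalerA mulr_algl scalerA.
    (* A vertex [l] other than [v] contributes only if [v < l <= w] and [v ~> l], which [nconn]
       excludes. *)
    move=> l lv; have [vl|vl] := leqP v l; last first.
      by rewrite (@pcoef_gt _ _ (vsval b)) -?ltnNge // mulr0.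
    have [lw|lw] := leqP l w; last by rewrite pcoef_gt -?ltnNge // mul0r.
    rewrite (pcoef_nconn (subvsP b)) ?mulr0 //; apply/negP => vlc.
    by case: nconn; exists l; split=> //; rewrite ltn_neqAle eq_sym (inj_eq val_inj) lv.
  case/eqP: m0; have := gp (path_elt K v w) m.
  rewrite /beta pcoef_path_id // scale1r scale1r => <-.
  rewrite -[path_elt K v w]mulr1 -pureZ H.
  by apply: (@addrI _ (g 0)); rewrite -gD !addr0.
rewrite -(path_mul K (ltnW vk) kw) -scalerA.
suff -> : path_elt K v k *: z = 0 by rewrite scaler0.
move: z; apply: annihilates_tensor => c u; rewrite mulrA path_corner ?(ltnW vk) //.
rewrite -mulr_algl -{1}(vsprojK Bvk) pure_bal scalV (vsprojK Bvk) pcoef_path.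
have -> : (v == k) = false by rewrite -(inj_eq val_inj) /= ltn_eqF.
by rewrite !andbF scale0r scale0r pure0r.
Qed.

Lemma tensor_intmod_annihilates i (s u t : 'I_n.+1) :
  isom (tensor B V) (intmod K i s) -> (u <= t)%N ->
  (forall z : tensor B V, path_elt K u t *: z = 0) <-> ~~ ((i <= u)%N && (t <= s)%N).
Proof. by move=> TM ut; rewrite (isom_annihilates _ TM) path_annihilates_intmod. Qed.

(** If [i < v], then [e_i] kills the tensor product but not [M(i,s)]; if [v < i], then [e_v] kills
    [M(i,s)] but not the tensor product. *)
Lemma tensor_intmod_top i (s : 'I_n.+1) : (exists m : V, m != 0) ->
  isom (tensor B V) (intmod K i s) -> (i <= s)%N -> v = i.
Proof.
move=> V0 TM is'; apply/val_inj/eqP; rewrite eqn_leq; apply/andP; split.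
  rewrite leqNgt; apply/negP => iv.
  have /(tensor_intmod_annihilates TM (leqnn i)) :
      forall z : tensor B V, idem K i *: z = 0.
    by move=> z; apply: idem_annihilates_tensor.
  by rewrite leqnn is'.
apply: contrapT => /negP iv.
have /(tensor_intmod_annihilates TM (leqnn v)) : ~~ ((i <= v)%N && (v <= s)%N).
  by rewrite (negPf iv).
rewrite path_annihilates_tensor // => -[k [vk kv _]].
by move: (leq_trans vk kv); rewrite ltnn.
Qed.

Lemma tensor_intmod_conn (s w : 'I_n.+1) : (exists m : V, m != 0) ->
  isom (tensor B V) (intmod K v s) -> (v <= w)%N ->
  (exists k, [/\ (v < k)%N, (k <= w)%N & conn v k]) <-> (s < w)%N.
Proof.
move=> V0 TM vw; rewrite -path_annihilates_tensor //.
by rewrite (tensor_intmod_annihilates TM vw) leqnn /= -ltnNge.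
Qed.

End SimpleModules.

(** With [w] varying, this says that the least [k > i] with [i ~> k] is [s + 1], and that there is
    none when [s] is the last vertex. *)
Lemma simple_tensor_intmod_conn (V : lmodType (subvs_of B)) i (s w : 'I_n.+1) :
  simple_module V -> isom (tensor B V) (intmod K i s) -> (i <= s)%N -> (i <= w)%N ->
  (exists k, [/\ (i < k)%N, (k <= w)%N & conn i k]) <-> (s < w)%N.
Proof.
move=> smpV TM is' iw; have [v scalV] := simple_module_scalar smpV.
have V0 := proj1 smpV; have vi := tensor_intmod_top scalV V0 TM is'.
by apply: (tensor_intmod_conn _ V0 TM) iw => b m; rewrite -vi.
Qed.

End Subalgebra.

(** * Finite-dimensional modules on convex sets of vertices *)

Lemma findim_span (K : fieldType) (R : falgType K) (V : lmodType R) (I : finType)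
    (e : I -> V) :
  (forall v, exists c : I -> K, v = \sum_i (c i)%:A *: e i) -> findim V.
Proof.
move=> H; exists [seq e i | i <- index_enum I] => v; have [c {1}->] := H v.
exists (fun k => nth 0 [seq c i | i <- index_enum I] k).
elim: (index_enum I) => [|i r IHr]; first by rewrite big_nil big_ord0.
by rewrite big_cons big_ord_recl IHr.
Qed.

(** This makes the action on [vertmod] associative: a composite of two paths of [B] between vertices
    of [U] never passes through a vertex outside [U]. *)
Definition path_convex (K : fieldType) n (B : {aspace pathalg K n}) (U : {set 'I_n.+1}) :=
  forall k l m, k \in U -> m \in U -> conn B k l -> conn B l m -> l \in U.

(* For [U] convex with respect to the paths in [B], the subquotient of [B]-modules
   having the vertices in [U] as a basis, on which a path from [k] to [l] in [B]
   sends [k] to [l]. *)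
Definition vertmod (K : fieldType) n (B : {aspace pathalg K n}) (U : {set 'I_n.+1})
    of (forall i, idem K i \in B) & path_convex B U :=
  {ffun {k : 'I_n.+1 | k \in U} -> K^o}.

Section VertexModule.
Variables (K : fieldType) (n : nat) (B : {aspace pathalg K n}) (U : {set 'I_n.+1}).
Hypotheses (he : forall i, idem K i \in B) (cU : path_convex B U).
Local Notation M := (vertmod he cU).

HB.instance Definition _ := GRing.Zmodule.on M.

Definition vertscale (b : subvs_of B) (v : M) : M :=
  [ffun l => \sum_(k : {k | k \in U}) pcoef (vsval b) (val k) (val l) * v k].

Lemma vertscaleA a b v : vertscale a (vertscale b v) = vertscale (a * b) v.
Proof.
apply/ffunP => m; rewrite !ffunE.
under eq_bigr do rewrite ffunE mulr_sumr.
rewrite exchange_big /=; apply: eq_bigr => k _; rewrite pcoef_mulr mulr_suml.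
rewrite (bigID (fun l => l \in U)) /= [X in _ + X]big1 ?addr0 => [|l lU].
  rewrite (reindex_omap (val : {k | k \in U} -> _) insub) /=.
    by apply: eq_big => [l | l _]; rewrite ?mulrA // valK eqxx andbT (valP l).
  by move=> l lU; rewrite insubT.
have [kl|kl] := boolP (conn B (val k) l); last first.
  by rewrite (pcoef_nconn he (subvsP b)) // mulr0 mul0r.
rewrite (pcoef_nconn he (subvsP a)) ?mul0r //; apply: contra lU => lm.
exact: cU (valP k) (valP m) kl lm.
Qed.

Lemma vertscale1 : left_id 1 vertscale.
Proof.
move=> v; apply/ffunP => l; rewrite ffunE vsval_one // (bigD1 l) //= pcoef1 eqxx mul1r.
rewrite big1 ?addr0 // => k kl; rewrite pcoef1.
by rewrite (inj_eq val_inj) (negPf kl) mul0r.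
Qed.

Lemma vertscaleDr : right_distributive vertscale +%R.
Proof.
move=> a v w; apply/ffunP => l; rewrite !ffunE -big_split /=.
by apply: eq_bigr => k _; rewrite ffunE mulrDr.
Qed.

Lemma vertscaleDl v : {morph vertscale^~ v : a b / a + b}.
Proof.
move=> a b; apply/ffunP => l; rewrite !ffunE -big_split /=.
by apply: eq_bigr => k _; rewrite pcoefD mulrDl.
Qed.

HB.instance Definition _ := GRing.Zmodule_isLmodule.Build (subvs_of B) M
  vertscaleA vertscale1 vertscaleDr vertscaleDl.

Definition vertex (k : 'I_n.+1) : M := [ffun l => (val l == k)%:R].

(** Extended by 0 outside [U], so that vectors on different vertex sets can be compared. *)
Definition vcoef (v : M) (k : 'I_n.+1) : K := if insub k is Some p then v p else 0.

Lemma vcoef_val v (p : {k | k \in U}) : vcoef v (val p) = v p.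
Proof. by rewrite /vcoef valK. Qed.

Lemma vcoef_out v k : k \notin U -> vcoef v k = 0.
Proof. by move=> kU; rewrite /vcoef insubN. Qed.

Lemma vcoef_inj v w : (forall k, k \in U -> vcoef v k = vcoef w k) -> v = w.
Proof. by move=> vw; apply/ffunP => p; rewrite -!vcoef_val vw ?(valP p). Qed.

Lemma vcoefE (f : 'I_n.+1 -> K^o) k : k \in U -> vcoef [ffun l => f (val l)] k = f k.
Proof.
by move=> kU; rewrite /vcoef; case: insubP => [p _ pk|/negP//]; rewrite ffunE pk.
Qed.

Lemma vcoefD v w k : vcoef (v + w) k = vcoef v k + vcoef w k.
Proof. by rewrite /vcoef; case: insub => [p|]; rewrite ?ffunE ?addr0. Qed.

Lemma vcoefZ b v l : l \in U ->
  vcoef (b *: v) l = \sum_(k in U) pcoef (vsval b) k l * vcoef v k.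
Proof.
move=> lU; rewrite /vcoef insubT ffunE /=.
rewrite [RHS](reindex_omap (val : {k | k \in U} -> _) insub) /=; last first.
  by move=> k kU; rewrite insubT.
by apply: eq_big => [k|k _]; rewrite valK ?eqxx ?(valP k).
Qed.

Lemma vcoef_vertex k l : l \in U -> vcoef (vertex k) l = (l == k)%:R.
Proof. by move=> lU; rewrite (vcoefE (fun l => (l == k)%:R)). Qed.

Lemma vertmod_scalar c v p : ((c%:A : subvs_of B) *: v : M) p = c * v p.
Proof.
rewrite ffunE (_ : vsval _ = c *: 1); last by rewrite -(vsval_one he).
rewrite (bigD1 p) //= pcoefZ pcoef1 eqxx mulr1 big1 ?addr0 // => q qp.
by rewrite pcoefZ pcoef1 (inj_eq val_inj) (negPf qp) mulr0 mul0r.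
Qed.

Lemma vertmod_findim : findim M.
Proof.
apply: (findim_span (e := fun p : {k | k \in U} => vertex (val p))) => v; exists v.
apply/ffunP => p; rewrite sum_ffunE (bigD1 p) //= big1 ?addr0 => [|q qp].
  by rewrite vertmod_scalar ffunE eqxx mulr1.
by rewrite vertmod_scalar ffunE (inj_eq val_inj) eq_sym (negPf qp) mulr0.
Qed.

End VertexModule.

Section VertexModuleMap.
Variables (K : fieldType) (n : nat) (B : {aspace pathalg K n}) (U V : {set 'I_n.+1}).
Hypotheses (he : forall i, idem K i \in B).
Hypotheses (cU : path_convex B U) (cV : path_convex B V).

(** One formula serves for the inclusion of a submodule and for the projection onto a quotient. *)
Definition vertmap (v : vertmod he cU) : vertmod he cV := [ffun l => vcoef v (val l)].

Lemma vcoef_vertmap v k : k \in V -> vcoef (vertmap v) k = vcoef v k.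
Proof. exact: vcoefE. Qed.

Hypothesis upV : forall k l, conn B k l -> k \in U -> k \in V -> l \in V -> l \in U.
Hypothesis downU : forall k l, conn B k l -> k \in U -> l \in U -> l \in V -> k \in V.

(** For a target in [U], the sums over [U] and [V] agree on common vertices; [downU] removes the
    rest of the first, extension by 0 the rest of the second. A target outside [U] is handled by
    [upV]. *)
Lemma vertmap_is_linear : linear vertmap.
Proof.
move=> b u v; apply: vcoef_inj => l lV; rewrite vcoefD !vcoef_vertmap // vcoefD.
congr (_ + _); rewrite [RHS]vcoefZ //.
have [lU|lU] := boolP (l \in U).
  rewrite vcoefZ // (bigID (fun k => k \in V)) [RHS](bigID (fun k => k \in U)) /=.
  congr (_ + _).
    apply: eq_big => [k|k /andP[kU kV]]; first by rewrite andbC.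
    by rewrite vcoef_vertmap.
  rewrite !big1 // => k /andP[kX kY].
    by rewrite vcoef_vertmap // vcoef_out // mulr0.
  rewrite (pcoef_nconn he (subvsP b)) ?mul0r //.
  by apply: contra kY => kl; apply: downU kl kX lU lV.
rewrite vcoef_out // big1 // => k kV; rewrite vcoef_vertmap //.
have [kU|kU] := boolP (k \in U); last by rewrite vcoef_out ?mulr0.
rewrite (pcoef_nconn he (subvsP b)) ?mul0r //.
by apply: contra lU => kl; apply: upV kl kU kV lV.
Qed.

HB.instance Definition _ := GRing.isLinear.Build (subvs_of B) _ _ *:%R vertmap
  vertmap_is_linear.

Definition vertmap_linear : {linear vertmod he cU -> vertmod he cV} := vertmap.

End VertexModuleMap.

(** * Exactness and paths of [B] with a common source *)

Section Forest.
Variables (K : fieldType) (n : nat) (B : {aspace pathalg K n}).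
Hypothesis he : forall i, idem K i \in B.
Hypothesis exB : tensor_exact B.
Variables h i j : 'I_n.+1.
Hypotheses (hi : conn B h i) (hj : conn B h j) (ij : (i <= j)%N).

(** [above], [upper] and [lower] index bases of the projective [B e_h], of its submodule generated
    by the paths from [h] to [i] and to [j], and of the quotient. *)
Let above := [set k | conn B h k].
Let upper := [set k | conn B i k || conn B j k].
Let lower := above :\: upper.

Lemma above_convex : path_convex B above.
Proof. by move=> k l m; rewrite !inE => hk _ kl _; apply: conn_trans hk kl. Qed.

Lemma upper_up k l : conn B k l -> k \in upper -> l \in upper.
Proof.
by rewrite !inE => kl /orP[ik|jk]; [rewrite (conn_trans ik kl)
  | rewrite (conn_trans jk kl) orbT].
Qed.

Lemma upper_convex : path_convex B upper.
Proof. by move=> k l m kU _ kl _; apply: upper_up kl kU. Qed.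

Lemma lower_convex : path_convex B lower.
Proof.
move=> k l m; rewrite !in_setD => /andP[_ ka] /andP[mU ma] kl lm.
rewrite (above_convex ka ma kl lm) andbT.
by apply: contra mU; apply: upper_up.
Qed.

Lemma upper_above k : k \in upper -> k \in above.
Proof. by rewrite !inE => /orP[]; apply: conn_trans. Qed.

Local Notation J := (vertmod he upper_convex).
Local Notation P := (vertmod he above_convex).
Local Notation Q := (vertmod he lower_convex).

Fact incl_up k l : conn B k l -> k \in upper -> k \in above -> l \in above -> l \in upper.
Proof. by move=> kl kU _ _; apply: upper_up kl kU. Qed.

Fact incl_down k l : conn B k l -> k \in upper -> l \in upper -> l \in above -> k \in above.
Proof. by move=> _ /upper_above. Qed.

Fact proj_up k l : conn B k l -> k \in above -> k \in lower -> l \in lower -> l \in above.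
Proof. by rewrite !in_setD => _ _ _ /andP[]. Qed.

Fact proj_down k l : conn B k l -> k \in above -> l \in above -> l \in lower -> k \in lower.
Proof.
rewrite !in_setD => kl -> _ /andP[lU _]; rewrite andbT.
by apply: contra lU; apply: upper_up.
Qed.

Let incl : {linear J -> P} := vertmap_linear he upper_convex above_convex incl_up incl_down.
Let proj : {linear P -> Q} := vertmap_linear he above_convex lower_convex proj_up proj_down.

(** [J], [P] and [Q] form a short exact sequence, to which [exB] applies. *)
Lemma tensor_incl_inj : injective (tensor_map incl).
Proof.
have [||||||//] := exB (f := incl) (g := proj).
- exact: vertmod_findim.
- exact: vertmod_findim.
- exact: vertmod_findim.
- move=> u v uv; apply: vcoef_inj => k kU; have ka := upper_above kU.
  by rewrite -(vcoef_vertmap above_convex u ka) -[vertmap _ _]/(incl u) uv vcoef_vertmap.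
- move=> y; split=> [y0|[x <-]].
    exists (vertmap _ y); apply: vcoef_inj => k ka; rewrite vcoef_vertmap //.
    have [kU|kU] := boolP (k \in upper); first by rewrite vcoef_vertmap.
    have kl : k \in lower by rewrite in_setD kU.
    rewrite vcoef_out // -(vcoef_vertmap lower_convex y kl) -[vertmap _ _]/(proj y) y0.
    by rewrite /vcoef insubT ffunE.
  apply: vcoef_inj => k kl; rewrite !vcoef_vertmap //; last first.
    by move: kl; rewrite in_setD => /andP[].
  rewrite vcoef_out; first by rewrite /vcoef insubT ffunE.
  by move: kl; rewrite in_setD => /andP[].
- move=> y; exists (vertmap _ y); apply: vcoef_inj => k kl; rewrite !vcoef_vertmap //.
  by move: kl; rewrite in_setD => /andP[].
Qed.

Lemma incl_vertex k (hk : conn B h k) : k \in upper ->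
  incl (vertex _ _ k) = Subvs (conn_mem hk) *: (vertex _ _ h : P).
Proof.
move=> kU; apply: vcoef_inj => l la; rewrite vcoef_vertmap // vcoefZ //.
have hU : h \in above by rewrite inE conn_refl.
rewrite (bigD1 h) //= big1 ?addr0 => [|m /andP[_ mh]]; last first.
  by rewrite pcoef_path (negPf mh) !andbF mul0r.
rewrite [X in _ * X]vcoef_vertex // eqxx mulr1 pcoef_path eqxx /=.
have [->|lk] := eqVneq l k; first by rewrite vcoef_vertex // eqxx (conn_leq hk).
rewrite andbF; have [lU|lU] := boolP (l \in upper); last by rewrite vcoef_out.
by rewrite vcoef_vertex // (negPf lk).
Qed.

(** The two tensors in [z] have the same image over [P], namely the path from [h] to [j] tensored
    with the vertex [h]. Injectivity identifies them over [J], where a coefficient at [j] would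
    separate them if [i ~> j] failed. *)
Lemma conn_forest : conn B i j.
Proof.
have [iU jU] : i \in upper /\ j \in upper by rewrite !inE !conn_refl // orbT.
pose z : tensor B J :=
  pure B (path_elt K i j) (vertex _ _ i) - pure B (idem K j) (vertex _ _ j).
have z0 : z = 0.
  apply: tensor_incl_inj; rewrite linear0 linearB /= !tensor_map_pure.
  rewrite (incl_vertex hi) // (incl_vertex hj) // -!pure_bal /=.
  by rewrite !path_mul ?(conn_leq hi) ?(conn_leq hj) // subrr.
apply: contrapT => /negP nij.
pose beta (a : pathalg K n) (x : J) : K := pcoef a j j * vcoef x j.
have [||| g [[gD gp] _]] := @tensor_univ K (pathalg K n) B J K beta.
- by move=> a a' x; rewrite /beta pcoefD mulrDl.
- by move=> a x x'; rewrite /beta vcoefD mulrDr.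
- move=> a b x; rewrite /beta vcoefZ // (bigD1 j) //= big1 ?addr0 => [|l /andP[lU lj]].
    rewrite mulrA pcoef_mulr (bigD1 j) //= big1 ?addr0 // => l lj.
    have [jl|lj'] := leqP j l; last by rewrite (@pcoef_gt _ _ (vsval b)) -?ltnNge // mulr0.
    rewrite pcoef_gt ?mul0r // -ltnNge ltn_neqAle jl andbT eq_sym.
    by rewrite (inj_eq val_inj).
  (* Suppose [l ~> j] with [l] in [upper]: [i ~> l] would give [i ~> j], and [j ~> l] would give
     [l = j]. *)
  rewrite (pcoef_nconn he (subvsP b)) ?mul0r //; apply/negP => clj.
  move: lU; rewrite inE => /orP[il|/conn_leq jl].
    by rewrite (conn_trans il clj) in nij.
  by case/eqP: lj; apply/val_inj/eqP; rewrite eqn_leq jl (conn_leq clj).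
have g0 : g 0 = 0 by apply: (@addrI _ (g 0)); rewrite -gD !addr0.
(* [g] is only known to be additive, so the subtracted tensor is added back before evaluating. *)
have : g (z + pure B (idem K j) (vertex _ _ j)) = g (pure B (idem K j) (vertex _ _ j)).
  by rewrite z0 add0r.
rewrite /z subrK !gp /beta !vcoef_vertex // pcoef_path_id // eqxx mulr1.
rewrite pcoef_path; have [ji|ji] := eqVneq j i.
  by rewrite ji conn_refl in nij.
by rewrite mulr0 => /eqP; rewrite eq_sym oner_eq0.
Qed.

End Forest.

(** * Words in a generating set *)

Definition word_product (K : fieldType) (A : falgType K) (S : A -> Prop) (a : A) :=
  exists w : seq A, [/\ w != [::], forall x, x \in w -> S x & a = \prod_(x <- w) x].

Section Words.
Variables (K : fieldType) (n : nat).
Local Notation A := (pathalg K n).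
Implicit Types (S : A -> Prop) (a x y : A).

Lemma word_product_mul S a a' :
  word_product S a -> word_product S a' -> word_product S (a * a').
Proof.
move=> [w [w0 Sw ->]] [w' [_ Sw' ->]]; exists (w ++ w'); split.
- by case: w w0 {Sw}.
- by move=> x; rewrite mem_cat => /orP[/Sw|/Sw'].
- by rewrite big_cat.
Qed.

Lemma word_product_mem S a : S a -> word_product S a.
Proof.
move=> Sa; exists [:: a]; rewrite big_seq1; split=> // x.
by rewrite inE => /eqP->.
Qed.

(** A path with coefficient 0 in [x] must still be assigned a nonempty word; [idem K ord0] is this
    default. *)
Lemma generated_by_paths S x : S (idem K ord0) ->
  (forall i j, pcoef x i j != 0 -> word_product S (path_elt K i j)) -> generated_by S x.
Proof.
move=> S0 H.
have /choice[w Hw] (p : qpath n) : exists w : seq A, [/\ w != [::],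
    forall y, y \in w -> S y
    & x p *: path_elt K (source p) (target p) = x p *: \prod_(y <- w) y].
  have [xp|xp] := eqVneq (x p) 0.
    by exists [:: idem K ord0]; split=> // [y|]; rewrite ?xp ?scale0r // inE => /eqP->.
  have [|w [w0 Sw ->]] := H (source p) (target p); first by rewrite pcoef_val.
  by exists w.
exists #|{: qpath n}|, (fun k => x (enum_val k)), (fun k => w (enum_val k)); split=> [k|].
  by have [] := Hw (enum_val k).
rewrite {1}(path_elt_sum x) (reindex _ (onW_bij _ (@enum_val_bij (qpath n)))) /=.
by apply: eq_bigr => k _; have [] := Hw (enum_val k).
Qed.

(* The elements of [B] whose coefficient at the path from [u] to [v] is 0 are closed
   under products, but [path_elt u v] is not one of them. *)
Lemma not_generated_by (B : {aspace A}) S (u v : 'I_n.+1) : (u <= v)%N ->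
  (forall x y, x \in B -> y \in B -> pcoef x u v = 0 -> pcoef y u v = 0 ->
     pcoef (x * y) u v = 0) ->
  (forall x, S x -> x \in B /\ pcoef x u v = 0) -> ~ generated_by S (path_elt K u v).
Proof.
move=> uv clM SB [m [c [w [Hw]]]] /(congr1 (fun x => pcoef x u v)).
rewrite pcoef_path_id // pcoef_sum big1 => [/eqP|k _]; first by rewrite oner_eq0.
rewrite pcoefZ; have [wk Sw] := Hw k; suff [_ ->] : (\prod_(x <- w k) x) \in B /\
    pcoef (\prod_(x <- w k) x) u v = 0 by rewrite mulr0.
elim: (w k) wk Sw => // a [|b r] IHr _ Sw; first by rewrite big_seq1; apply/SB/Sw/mem_head.
have [Ba a0] := SB _ (Sw _ (mem_head _ _)).
have [//|x xr|Br r0] := IHr; first by apply: Sw; rewrite inE xr orbT.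
by rewrite big_cons memvM // clM.
Qed.

End Words.

(** * Generation and minimality from the combinatorics of [conn] *)

Section Generators.
Variables (K : fieldType) (n : nat) (s : 'I_n.+1 -> 'I_n.+1) (B : {aspace pathalg K n}).
Hypothesis s_ge : forall i : 'I_n.+1, (i <= s i)%N.
Hypothesis he : forall i, idem K i \in B.
Hypothesis s_conn : forall i w : 'I_n.+1, (i <= w)%N ->
  (exists k : 'I_n.+1, [/\ (i < k)%N, (k <= w)%N & conn B i k]) <-> (s i < w)%N.

Lemma conn_gap (i k : 'I_n.+1) : conn B i k -> (i < k)%N -> (s i < k)%N.
Proof. by move=> ik lt_ik; apply/s_conn; [exact: ltnW | exists k]. Qed.

(** [s_conn] at [w = l] gives some [k <= l] with [i ~> k], and [conn_gap] leaves only [k = l]. *)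
Lemma conn_next (i l : 'I_n.+1) : l = (s i).+1 :> nat -> conn B i l.
Proof.
move=> lE; have il : (i <= l)%N by rewrite lE (leq_trans (s_ge i)).
have [|k [ik kl cik]] := proj2 (s_conn il); first by rewrite lE.
suff -> : l = k by [].
by apply/val_inj/eqP; rewrite eqn_leq kl andbT /= lE; apply: conn_gap.
Qed.

Lemma borel_generatorsP a : borel_generators K s a ->
  exists u v : 'I_n.+1, [/\ a = path_elt K u v, conn B u v
    & (v : nat) = u \/ (v : nat) = (s u).+1].
Proof.
case=> [[i ->]|[i si ->]]; first by exists i, i; split; [| exact: conn_refl | left].
have li : ((s i).+1 < n.+1)%N by [].
exists i, (Ordinal li); rewrite (alpha_prodE K (s_ge i) (erefl : Ordinal li = _ :> nat)).
by split; [| exact: conn_next | right].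
Qed.

(** A nontrivial path of [B] from [u] ends beyond [s u], so an intermediate vertex other than [u]
    and [v] would lie beyond [v]. *)
Lemma irreducible_pcoef (u v : 'I_n.+1) : (v : nat) = u \/ (v : nat) = (s u).+1 ->
  forall x y, x \in B -> y \in B -> pcoef x u v = 0 -> pcoef y u v = 0 ->
    pcoef (x * y) u v = 0.
Proof.
move=> uv x y Bx By x0 y0; rewrite pcoef_mulr big1 // => l _.
have [->|lu] := eqVneq l u; first by rewrite x0 mul0r.
have [->|lv] := eqVneq l v; first by rewrite y0 mulr0.
have [ul|nul] := boolP (conn B u l); last by rewrite (pcoef_nconn he By nul) mulr0.
rewrite pcoef_gt ?mul0r // -ltnNge.
have lt_ul : (u < l)%N by rewrite ltn_neqAle (conn_leq ul) // andbT eq_sym (inj_eq val_inj).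
case: uv => vE; first by rewrite vE.
by rewrite ltn_neqAle eq_sym (inj_eq val_inj) lv /= vE conn_gap.
Qed.

Hypothesis forest : forall h i j : 'I_n.+1,
  conn B h i -> conn B h j -> (i <= j)%N -> conn B i j.

(** Induction on the length: [conn_next] splits off the generator from [i] to [s i + 1], and
    [forest] puts the remaining path in [B]. *)
Lemma conn_word_product i j : conn B i j ->
  word_product (borel_generators K s) (path_elt K i j).
Proof.
have [m] := ubnP (j - i); elim: m i => // m IHm i ltm cij.
have := conn_leq cij; rewrite leq_eqVlt => /orP[/eqP/val_inj<-|ij].
  by apply: word_product_mem; left; exists i.
have sj := conn_gap cij ij; have li : ((s i).+1 < n.+1)%N by apply: leq_ltn_trans sj _.
pose l := Ordinal li; have cil : conn B i l by apply: conn_next.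
have clj : conn B l j by apply: forest cil cij sj.
rewrite -(path_mul K (conn_leq cil) sj); apply: word_product_mul.
  apply: (IHm l _ clj); rewrite -ltnS; apply: leq_trans ltm; rewrite ltnS.
  by apply: ltn_sub2l => //=; rewrite ltnS s_ge.
apply: word_product_mem; right; exists i => //.
by rewrite (alpha_prodE K (s_ge i) (erefl : l = _ :> nat)).
Qed.

Lemma borel_generators_minimal : minimal_generating_set (borel_generators K s) B.
Proof.
split.
  split=> [a /borel_generatorsP[u [v [-> uv _]]]|b Bb]; first exact: conn_mem.
  apply: generated_by_paths => [|i j /(pcoef_conn he Bb)]; last exact: conn_word_product.
  by left; exists ord0.
(* A generator [a] missing from [S'] is a path from [u] to [v], and every element of [S'], being a
   different path, has coefficient 0 there. *)
move=> S' [sub nsub] [S'B genB]; apply: nsub => a Sa; apply: contrapT => S'a.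
have [u [v [aE uv irr]]] := borel_generatorsP Sa.
have := genB a (_ : a \in B); rewrite {1 2}aE => /(_ (conn_mem uv)).
apply: (not_generated_by (conn_leq uv) (irreducible_pcoef irr)) => x S'x.
split; first exact: S'B.
have [u' [v' [xE _ _]]] := borel_generatorsP (sub _ S'x).
rewrite xE pcoef_path; case: eqP => [uu|]; last by rewrite andbF.
case: eqP => [vv|]; last by rewrite !andbF.
by case: S'a; rewrite aE uu vv -xE.
Qed.

End Generators.

Theorem proposition34 (K : closedFieldType) (n : nat)
    (T : bintree 'I_n.+1) (hT : inorder T = enum 'I_n.+1)
    (s : 'I_n.+1 -> 'I_n.+1)
    (hs : forall i : 'I_n.+1, (i <= s i)%N /\
       is_standard (fun j => intmod K j j) (tree_le T) i (intmod K i (s i)))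
    (B : {aspace pathalg K n})
    (hB : regular_exact_borel B (fun j => intmod K j j) (tree_le T))
    (he : forall i : 'I_n.+1, idem K i \in B) :
  minimal_generating_set (borel_generators K s) B.
Proof.
case: hB => LB [[_ [[_ _ _ [simpleLB _ _] _] _] exB stdB] _].
apply: borel_generators_minimal => // [i|i w iw|h i j hi hj ij].
- by have [] := hs i.
- have [is' std] := hs i.
  exact: (simple_tensor_intmod_conn he (simpleLB i) (stdB _ _ std) is' iw).
- exact: (conn_forest he exB hi hj ij).
Qed.
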